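(* Let $V=T_{p_0}S$, $m=\dim V$, $a_0=\mathcal A_{E,\mathrm{core}}(p_0)$, $W=T_{a_0}\mathscr X_{\mathrm{core}}$ and $L=\mathcal D_{g_0}:V\to W$. Then the following hold. (1) Every core-package-generated scalar response $D_{p_0}(\psi\circ\mathcal A_{E,\mathrm{core}})$ vanishes on $\ker L$. (2) An infinitesimally complete family of core-package-generated scalar observations can exist only if $L$ is injective. (3) Assume that $L$ is injective and that the admissible class $E$ satisfies the scalar richness hypothesis. Then there exist $\psi_1,\dots,\psi_m\in E$ such that the joint scalar observable $$\Theta=\left(\psi_1\circ\mathcal A_{E,\mathrm{core}},\dots,\psi_m\circ\mathcal A_{E,\mathrm{core}}\right):S\to\mathbb R^m$$ is infinitesimally complete at $g_0$.
   Context: $S$ is a smooth finite-dimensional manifold parameterizing a smooth family $p\mapsto g_p$ of normalized cohomogeneity-one Einstein metrics ($\operatorname{Ric}(g_p)=\lambda g_p$, $\lambda>0$ fixed, invariant under a fixed Lie group action, normalized by a fixed unit-speed normal geodesic) on a compact manifold $M$, with $g_{p_0}=g_0$ the reference metric. Fixed probe data are given: a compact Riemannian target $(N,h)$ with compatible group action, an equivariant homotopy class of maps $M\to N$ with endpoint, smoothness and normalization conditions, and a reference harmonic map $f_0$ for $g_0$. Under normalized Jacobi nondegeneracy (the linearization at $f_0$ of the tension field in the map variable, between the constrained equivariant $C^{k+2,\alpha}$ and $C^{k,\alpha}$ Hölder spaces, $k\ge4$, $0<\alpha<1$, is an isomorphism) and after shrinking $S$ around $p_0$, each $g_p$ has a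 unique harmonic map $f_p$ near $f_0$, depending smoothly on $p$; $J_p$ denotes the linearization at $f_p$ of the tension field $f\mapsto\tau_{g_p}(f)$, which is invertible, and $G_p=J_p^{-1}$. The (descended) core analytical package is the smooth map $\mathcal A_{E,\mathrm{core}}:S\to\mathscr X_{\mathrm{core}}$, $p\mapsto(J_p,G_p)$, where (after fixed local trivializations) $\mathscr X_{\mathrm{core}}$ is a Banach manifold of operator data. The universal response differential is $\mathcal D_{g_0}:=D_{p_0}\mathcal A_{E,\mathrm{core}}$. A core-package-generated scalar observation is a function $\psi\circ\mathcal A_{E,\mathrm{core}}$ with $\psi$ a smooth real function on $\mathscr X_{\mathrm{core}}$ defined near $a_0$; its differential at $p_0$ is its response. A family of observations (or a joint observable) is infinitesimally complete at $g_0$ if its joint differential at $p_0$ is injective on $V$, i.e. the kernels of the individual differentials intersect in $\{0\}$. Admissible class and scalar richness: $E$ is a Banach space of admissible smooth scalar postprocessings $\psi:\mathscr X_{\mathrm{core}}\to\mathbb R$ defined near $a_0$. Let $\rho:E\to L(V)^*$, $\rho(\psi)=d\psi_{a_0}|_{L(V)}$. $E$ satisfies the scalar richness hypothesis at $g_0$ if $E$ is continuously embedded in the local $C^1$ postprocessing space, $\rho$ is continuous, and $\rho$ is surjective. *)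

(* Defs.v *)
From HB Require Import structures.
From mathcomp Require Import all_boot all_order all_algebra.
From mathcomp Require Import all_classical all_reals all_analysis.

Set Implicit Arguments.
Unset Strict Implicit.
Unset Printing Implicit Defensive.

Import Order.TTheory GRing.Theory Num.Theory numFieldNormedType.Exports.
Local Open Scope classical_set_scope.
Local Open Scope ring_scope.

Section Calculus.
Context {R : realType}.

(* The tangent map (x, v) |-> f'(x) v. *)
Definition tang {E F : normedModType R} (f : E -> F) (z : E * E) : F :=
  'd f (z.1) (z.2).

(* C^n is measured on iterated tangent maps, which avoids norming spaces of
   multilinear maps.  On finite-dimensional E each level is the usual C^n; on
   Banach spaces level n+1 implies Frechet-C^n, so smooth_on is the usual
   C^infinity. *)
Fixpoint Ck (n : nat) {E F : normedModType R} (U : set E) (f : E -> F) : Prop :=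
  if n is n'.+1 then
    (forall x, U x -> differentiable f x) /\ Ck n' (U `*` setT) (tang f)
  else forall x, U x -> {for x, continuous f}.

Definition smooth_on {E F : normedModType R} (U : set E) (f : E -> F) : Prop :=
  forall n, Ck n U f.

Definition smooth_near {E F : normedModType R} (f : E -> F) (x : E) : Prop :=
  exists2 U, open_nbhs x U & smooth_on U f.

Definition loc_holder (al : R) {E F : normedModType R} (U : set E)
    (f : E -> F) : Prop :=
  forall x, U x -> exists V C, nbhs x V /\
    forall y z, V y -> V z -> `|f y - f z| <= C * `|y - z| `^ al.

Fixpoint CkH (k : nat) (al : R) {E F : normedModType R} (U : set E)
    (f : E -> F) : Prop :=
  if k is k'.+1 then
    (forall x, U x -> differentiable f x) /\ CkH k' al (U `*` setT) (tang f)
  else loc_holder al U f.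

(* f and h are eps-close in C^{k,al} on K, up to constants depending only on
   k, al and K when K is a closed ball. *)
Fixpoint hclose (k : nat) (al eps : R) {E F : normedModType R} (K : set E)
    (f h : E -> F) : Prop :=
  (forall x, K x -> `|f x - h x| <= eps) /\
  if k is k'.+1 then
    hclose k' al eps (K `*` [set v | `|v| <= 1]) (tang f) (tang h)
  else forall x y, K x -> K y ->
    `|(f x - h x) - (f y - h y)| <= eps * `|x - y| `^ al.

Definition topological_iso {E F : normedModType R} (J : E -> F) (G : F -> E) :
    Prop :=
  [/\ linear J, continuous J, continuous G, cancel J G & cancel G J].

End Calculus.

(* Only the restriction of cfun to cdom, and of cinv to the image of cdom,
   is meaningful. *)
Record chart (R : realType) (T : topologicalType) (E : normedModType R) :=
  Chart { cdom : set T; cfun : T -> E; cinv : E -> T }.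

Section Charts.
Context {R : realType}.

Definition cimg {T : topologicalType} {E : normedModType R} (c : chart T E) :
  set E := cfun c @` cdom c.

Definition is_chart {T : topologicalType} {E : normedModType R}
    (c : chart T E) : Prop :=
  [/\ open (cdom c), open (cimg c),
      forall x, cdom c x -> cinv c (cfun c x) = x,
      forall x, cdom c x -> {for x, continuous (cfun c)} &
      forall y, cimg c y -> {for y, continuous (cinv c)}].

Definition id_chart (E : normedModType R) : chart E E := Chart setT id id.

Definition prod_chart {T1 T2 : topologicalType} {E1 E2 : normedModType R}
    (c1 : chart T1 E1) (c2 : chart T2 E2) : chart (T1 * T2)%type (E1 * E2)%type :=
  Chart (cdom c1 `*` cdom c2)
    (fun x => (cfun c1 x.1, cfun c2 x.2)) (fun y => (cinv c1 y.1, cinv c2 y.2)).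

Definition chart_smooth {T T' : topologicalType} {E E' : normedModType R}
    (c : chart T E) (d : chart T' E') (f : T -> T') (x : T) : Prop :=
  {for x, continuous f} /\ smooth_near (cfun d \o f \o cinv c) (cfun c x).

Definition chart_deriv {T T' : topologicalType} {E E' : normedModType R}
    (c : chart T E) (d : chart T' E') (f : T -> T') (x : T) : E -> E' :=
  'd (cfun d \o f \o cinv c) (cfun c x).

End Charts.

(* The tangent space at x is the model space E, read in the preferred chart
   chart_at x. *)
Record manifold (R : realType) (E : normedModType R) := Manifold {
  mcarrier :> topologicalType;
  atlas : set (chart mcarrier E);
  chart_at : mcarrier -> chart mcarrier E;
  mfd_hausdorff : hausdorff_space mcarrier;
  mfd_chart : forall c, atlas c -> is_chart c;
  mfd_compat : forall c d, atlas c -> atlas d ->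
    smooth_on (cfun c @` (cdom c `&` cdom d)) (cfun d \o cinv c);
  mfd_chart_at : forall x, atlas (chart_at x);
  mfd_dom : forall x, cdom (chart_at x) x }.
Arguments chart_at {R E m} x.

Section Manifolds.
Context {R : realType}.

Definition msmooth {E F : normedModType R} {X : manifold E} {Y : manifold F}
    (f : X -> Y) : Prop :=
  forall x, chart_smooth (chart_at x) (chart_at (f x)) f x.

(* D_x f : T_x X -> T_(f x) Y *)
Definition mderiv {E F : normedModType R} {X : manifold E} {Y : manifold F}
    (f : X -> Y) (x : X) : E -> F :=
  chart_deriv (chart_at x) (chart_at (f x)) f x.

Definition vsmooth_at {E F : normedModType R} {X : manifold E}
    (f : X -> F) (x : X) : Prop := chart_smooth (chart_at x) (id_chart F) f x.

Definition vderiv {E F : normedModType R} {X : manifold E}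
    (f : X -> F) (x : X) : E -> F := chart_deriv (chart_at x) (id_chart F) f x.

(* Components in the chart c of the tangent vector v at x. *)
Definition tpush {E : normedModType R} {X : manifold E} (c : chart X E)
    (x : X) (v : E) : E := chart_deriv (chart_at x) c id x v.

Definition mjac {m n : nat} {X : manifold 'rV[R]_m} {Y : manifold 'rV[R]_n}
    (f : X -> Y) (x : X) : 'M[R]_(m, n) :=
  jacobian (cfun (chart_at (f x)) \o f \o cinv (chart_at x))
    (cfun (chart_at x) x).

End Manifolds.

Record lie_group (R : realType) (q : nat) := LieGroup {
  lie_mfd :> manifold 'rV[R]_q;
  lie_one : lie_mfd;
  lie_mul : lie_mfd -> lie_mfd -> lie_mfd;
  lie_inv : lie_mfd -> lie_mfd;
  lie_countable : @second_countable lie_mfd;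
  lie_mulA : associative lie_mul;
  lie_mul1 : left_id lie_one lie_mul;
  lie_mulV : left_inverse lie_one lie_inv lie_mul;
  lie_mul_smooth : forall a b : lie_mfd,
    chart_smooth (prod_chart (chart_at a) (chart_at b))
      (chart_at (lie_mul a b)) (fun z => lie_mul z.1 z.2) (a, b);
  lie_inv_smooth : msmooth lie_inv }.

Section Actions.
Context {R : realType} {q n : nat} {G : lie_group R q} {M : manifold 'rV[R]_n}.
Implicit Type act : G -> M -> M.

Definition smooth_action act : Prop :=
  [/\ forall x, act (lie_one G) x = x,
      forall a b x, act (lie_mul a b) x = act a (act b x) &
      forall a x, chart_smooth (prod_chart (chart_at a) (chart_at x))
        (chart_at (act a x)) (fun z => act z.1 z.2) (a, x)].

(* Lie algebra -> T_x M; its image is the tangent space of the orbit of x. *)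
Definition orbit_jac act (x : M) : 'M[R]_(q, n) :=
  mjac (fun a : G => act a x : M) (lie_one G).

(* The maximal orbit dimension is n - 1. *)
Definition cohomogeneity_one act : Prop :=
  (forall x, (\rank (orbit_jac act x) < n)%N) /\
  (exists x, (\rank (orbit_jac act x)).+1 = n).

End Actions.

Section LocalGeometry.
Context {R : realType} {n : nat}.
Implicit Type (g : 'rV[R]_n -> 'M[R]_n) (y : 'rV[R]_n).

Definition pd (i : 'I_n) (f : 'rV[R]_n -> R) y : R := 'D_(delta_mx 0 i) f y.

Definition christoffel g y (k i j : 'I_n) : R :=
  2^-1 * \sum_l invmx (g y) k l *
    (pd i (fun z => g z j l) y + pd j (fun z => g z i l) y
     - pd l (fun z => g z i j) y).

Definition ricci g y (i j : 'I_n) : R :=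
  \sum_k (pd k (fun z => christoffel g z k i j) y
          - pd j (fun z => christoffel g z k i k) y)
  + \sum_k \sum_l (christoffel g y k k l * christoffel g y l i j
                   - christoffel g y k j l * christoffel g y l i k).

End LocalGeometry.

Section Metrics.
Context {R : realType} {n : nat} {M : manifold 'rV[R]_n}.

(* g x is the Gram matrix on T_x M in the preferred chart at x. *)
Implicit Type g : M -> 'M[R]_n.

Definition inner g (x : M) (v w : 'rV[R]_n) : R := (v *m g x *m w^T) 0 0.

(* Gram matrices of g in the coordinates of the chart c. *)
Definition gloc g (c : chart M 'rV[R]_n) (y : 'rV[R]_n) : 'M[R]_n :=
  let x := cinv c y in
  let A := jacobian (cfun (chart_at x) \o cinv c) y in
  A *m g x *m A^T.

Definition riemannian g : Prop :=
  [/\ forall x, (g x)^T = g x,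
      forall x v, v != 0 -> 0 < inner g x v v &
      forall x i j, smooth_near (fun y => gloc g (chart_at x) y i j)
        (cfun (chart_at x) x)].

Definition einstein (lam : R) g : Prop := forall (x : M) i j,
  let c := chart_at x in
  ricci (gloc g c) (cfun c x) i j = lam * gloc g c (cfun c x) i j.

Definition invariant_metric {q : nat} {G : lie_group R q} (act : G -> M -> M) g :
    Prop :=
  forall a x, let A := mjac (act a) x in A *m g (act a x) *m A^T = g x.

Definition smooth_curve (gam : R -> M) : Prop :=
  forall t, chart_smooth (id_chart R) (chart_at (gam t)) gam t.

Definition velocity (gam : R -> M) (t : R) : 'rV[R]_n :=
  chart_deriv (id_chart R) (chart_at (gam t)) gam t 1.

Definition geodesic g (gam : R -> M) : Prop := smooth_curve gam /\
  forall t (k : 'I_n),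
    let c := chart_at (gam t) in
    let y i s := cfun c (gam s) 0 i in
    derive1n 2 (y k) t
    + \sum_i \sum_j christoffel (gloc g c) (cfun c (gam t)) k i j
                    * derive1 (y i) t * derive1 (y j) t = 0.

Definition unit_normal_geodesic {q : nat} {G : lie_group R q}
    (act : G -> M -> M) g (gam : R -> M) : Prop :=
  [/\ geodesic g gam,
      forall t, inner g (gam t) (velocity gam t) (velocity gam t) = 1 &
      forall t (xi : 'rV[R]_q),
        inner g (gam t) (xi *m orbit_jac act (gam t)) (velocity gam t) = 0].

End Metrics.

Record normalized_einstein_family {R : realType} {m n q : nat}
    {S : manifold 'rV[R]_m} {M : manifold 'rV[R]_n} {G : lie_group R q}
    (act : G -> M -> M) (lam : R) (gam : R -> M) (g : S -> M -> 'M[R]_n) : Prop :=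
  NormalizedEinsteinFamily {
  nef_action : smooth_action act;
  nef_coh1 : cohomogeneity_one act;
  nef_lam : 0 < lam;
  nef_metric : forall p, riemannian (g p);
  nef_invariant : forall p, invariant_metric act (g p);
  nef_einstein : forall p, einstein lam (g p);
  nef_normal : forall p, unit_normal_geodesic act (g p) gam;
  nef_smooth : forall (p : S) (x : M) i j,
    smooth_near (fun z : 'rV[R]_m * 'rV[R]_n =>
        gloc (g (cinv (chart_at p) z.1)) (chart_at x) z.2 i j)
      (cfun (chart_at p) p, cfun (chart_at x) x) }.

Section Maps.
Context {R : realType} {n d q : nat}.
Context {M : manifold 'rV[R]_n} {N : manifold 'rV[R]_d} {G : lie_group R q}.
Variables (actM : G -> M -> M) (actN : G -> N -> N).
Implicit Type (f : M -> N).

(* A section xi of f^* TN is a map with xi x in T_(f x) N, i.e. read in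
   chart_at (f x). *)
Implicit Type (xi : M -> 'rV[R]_d).

(* tr_g (Nabla df) in coordinates *)
Definition tension (g : M -> 'M[R]_n) (h : N -> 'M[R]_d) f (x : M) : 'rV[R]_d :=
  let c := chart_at x in
  let e := chart_at (f x) in
  let y := cfun c x in
  let u a z := cfun e (f (cinv c z)) 0 a in
  \row_a \sum_i \sum_j invmx (gloc g c y) i j *
    (pd i (pd j (u a)) y
     - \sum_k christoffel (gloc g c) y k i j * pd k (u a) y
     + \sum_b \sum_b' christoffel (gloc h e) (cfun e (f x)) a b b'
                      * pd i (u b) y * pd j (u b') y).

Definition harmonic_map g h f : Prop := forall x, tension g h f x = 0.

Definition equivariant f : Prop := forall a x, f (actM a x) = actN a (f x).

Definition equivariant_homotopic (f0 f1 : M -> N) : Prop :=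
  exists H : R -> M -> N,
    [/\ {within [set z : R * M | 0 <= z.1 <= 1], continuous (fun z : R * M => H z.1 z.2)},
        forall t, 0 <= t <= 1 -> equivariant (H t), H 0 = f0 & H 1 = f1].

Definition holder_map (k : nat) (al : R) f : Prop := forall x,
  {for x, continuous f} /\
  exists2 U, open_nbhs (cfun (chart_at x) x) U &
    CkH k al U (cfun (chart_at (f x)) \o f \o cinv (chart_at x)).

Definition holder_section (k : nat) (al : R) f xi : Prop := forall x,
  exists2 U, open_nbhs (cfun (chart_at x) x) U &
    CkH k al U (fun y => let z := cinv (chart_at x) y in
                         tpush (chart_at (f x)) (f z) (xi z)).

Definition equivariant_section f xi : Prop := forall a x,
  xi (actM a x) = mderiv (actN a) (f x) (xi x).

(* P contains all maps that are C^{k,al}-close to f0 on finitely many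
   coordinate balls covering M. *)
Definition holder_nbhs (k : nat) (al : R) (f0 : M -> N) (P : set (M -> N)) :
    Prop :=
  exists (D : set M) (r : M -> R) (eps : R),
  let B (x : M) := [set y : 'rV[R]_n | `|y - cfun (chart_at x) x| <= r x] in
  [/\ finite_set D /\ 0 < eps,
      forall x, D x -> [/\ 0 < r x, B x `<=` cimg (chart_at x) &
        forall y, B x y -> cdom (chart_at (f0 x)) (f0 (cinv (chart_at x) y))],
      forall z : M, exists x, [/\ D x, cdom (chart_at x) z &
        B x (cfun (chart_at x) z)] &
      forall f,
        (forall x, D x ->
          (forall y, B x y ->
            cdom (chart_at (f0 x)) (f (cinv (chart_at x) y))) /\
          hclose k al eps (B x) (cfun (chart_at (f0 x)) \o f0 \o cinv (chart_at x))
            (cfun (chart_at (f0 x)) \o f \o cinv (chart_at x))) ->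
        P f].

(* The endpoint, smoothness and normalization conditions are arbitrary
   predicates: cmap on maps, cvar on variation fields (the linearized
   conditions), cres on sections in which the tension field takes values. *)
Variables (k : nat) (al : R) (f0 : M -> N) (cmap : set (M -> N)).
Variables (cvar cres : (M -> N) -> set (M -> 'rV[R]_d)).

Definition admissible_maps : set (M -> N) := [set f |
  [/\ equivariant f, equivariant_homotopic f0 f, holder_map k.+2 al f & cmap f]].

Definition variation_space f : set (M -> 'rV[R]_d) := [set xi |
  [/\ equivariant_section f xi, holder_section k.+2 al f xi & cvar f xi]].

Definition residual_space f : set (M -> 'rV[R]_d) := [set xi |
  [/\ equivariant_section f xi, holder_section k al f xi & cres f xi]].

(* Phi is a Banach chart around f0 of the space of admissible maps, and Theta a
   trivialization over it of the bundle of residual spaces.  No norm on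
   B1 or B2 is prescribed: point evaluations being continuous, the closed graph
   theorem makes the norms equivalent to the Hoelder norms. *)
Record local_trivialization {B1 B2 : completeNormedModType R} (U : set B1)
    (Phi : B1 -> M -> N) (Theta : B1 -> B2 -> M -> 'rV[R]_d) : Prop :=
  LocalTrivialization {
  lt_open : open U;
  lt_inj : forall u v, U u -> U v -> Phi u = Phi v -> u = v;
  lt_adm : Phi @` U `<=` admissible_maps;
  lt_nbhs : holder_nbhs k.+2 al f0
    [set f | admissible_maps f -> (Phi @` U) f];
  lt_base : (Phi @` U) f0;
  lt_smooth : forall u x, U u ->
    chart_smooth (id_chart B1) (chart_at (Phi u x)) (fun w => Phi w x) u;
  lt_tangent : forall u, U u ->
    set_bij setT (variation_space (Phi u))
      (fun v x => chart_deriv (id_chart B1) (chart_at (Phi u x))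
                    (fun w => Phi w x) u v);
  lt_linear : forall u a b b' x, U u ->
    Theta u (a *: b + b') x = a *: Theta u b x + Theta u b' x;
  lt_residual : forall u, U u ->
    set_bij setT (residual_space (Phi u)) (Theta u);
  lt_residual_smooth : forall u b x, U u ->
    smooth_near (fun z : B1 * B2 =>
      tpush (chart_at (Phi u x)) (Phi z.1 x) (Theta z.1 z.2 x)) (u, b) }.

(* The linearization at the zero u p of the local tension field. *)
Definition jacobi {T : Type} {B1 B2 : completeNormedModType R}
    (tau : T -> B1 -> B2) (u : T -> B1) (p : T) : B1 -> B2 := 'd (tau p) (u p).

(* tau p is the tension field of g p read in the trivialization, Phi (u p) the
   harmonic map f_p, and Gr p the inverse G_p of the Jacobi operator. *)
Record harmonic_family {m : nat} {S : manifold 'rV[R]_m} (p0 : S)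
    (g : S -> M -> 'M[R]_n) (h : N -> 'M[R]_d)
    {B1 B2 : completeNormedModType R} (U : set B1)
    (Phi : B1 -> M -> N) (Theta : B1 -> B2 -> M -> 'rV[R]_d)
    (tau : S -> B1 -> B2) (u : S -> B1) (Gr : S -> B2 -> B1) : Prop :=
  HarmonicFamily {
  hf_tau : forall p w, U w -> Theta w (tau p w) = tension (g p) h (Phi w);
  hf_tau_smooth : forall p w, U w ->
    chart_smooth (prod_chart (chart_at p) (id_chart B1)) (id_chart B2)
      (fun z : S * B1 => tau z.1 z.2) (p, w);
  hf_dom : forall p, U (u p);
  hf_base : Phi (u p0) = f0;
  hf_nondegenerate : exists G0, topological_iso (jacobi tau u p0) G0;
  hf_harmonic : forall p, harmonic_map (g p) h (Phi (u p));
  hf_unique : forall p w, U w -> harmonic_map (g p) h (Phi w) -> w = u p;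
  hf_smooth : forall p, vsmooth_at u p;
  hf_green : forall p, topological_iso (jacobi tau u p) (Gr p) }.

End Maps.

Section Core.
Context {R : realType}.

(* X is a Banach manifold of pairs of bounded operators, injectively immersed in
   L(B1,B2) x L(B2,B1) by x |-> (opJ x, opG x).  Smoothness into the operator
   spaces is expressed by joint smoothness, to which it is equivalent: opJ x is
   the partial derivative at b = 0 of (x, b) |-> opJ x b. *)
Record operator_manifold {F B1 B2 : completeNormedModType R} {X : manifold F}
    (opJ : X -> B1 -> B2) (opG : X -> B2 -> B1) : Prop := OperatorManifold {
  om_linJ : forall x, linear (opJ x) /\ continuous (opJ x);
  om_linG : forall x, linear (opG x) /\ continuous (opG x);
  om_smoothJ : forall x b,
    chart_smooth (prod_chart (chart_at x) (id_chart B1)) (id_chart B2)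
      (fun z : X * B1 => opJ z.1 z.2) (x, b);
  om_smoothG : forall x b,
    chart_smooth (prod_chart (chart_at x) (id_chart B2)) (id_chart B1)
      (fun z : X * B2 => opG z.1 z.2) (x, b);
  om_inj : forall x y, opJ x = opJ y -> opG x = opG y -> x = y;
  om_immersion : forall (x : X) (w : F),
    (forall b, vderiv (fun z => opJ z b) x w = 0) ->
    (forall b, vderiv (fun z => opG z b) x w = 0) -> w = 0 }.

Record core_package {m : nat} {S : manifold 'rV[R]_m}
    {F B1 B2 : completeNormedModType R} {X : manifold F}
    (opJ : X -> B1 -> B2) (opG : X -> B2 -> B1)
    (J : S -> B1 -> B2) (Gr : S -> B2 -> B1) (A : S -> X) : Prop := CorePackage {
  cp_operators : operator_manifold opJ opG;
  cp_smooth : msmooth A;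
  cp_J : forall p, opJ (A p) = J p;
  cp_G : forall p, opG (A p) = Gr p }.

(* psi is a smooth function defined near a; its values away from a are junk. *)
Definition smooth_about {F : normedModType R} {X : manifold F} (a : X)
    (psi : X -> R) : Prop :=
  exists2 O, open_nbhs a O & forall x, O x -> vsmooth_at psi x.

Definition infinitesimally_complete {E : normedModType R} {S : manifold E}
    (p0 : S) {I : Type} (obs : I -> S -> R) : Prop :=
  injective (fun (v : E) (i : I) => vderiv (obs i) p0 v).

Definition joint_infinitesimally_complete {E : normedModType R} {S : manifold E}
    (p0 : S) {r : nat} (Theta : S -> 'rV[R]_r) : Prop :=
  injective (vderiv Theta p0).

(* A Banach space of smooth functions on a fixed neighbourhood O of a. *)
Record admissible_class {F : normedModType R} {X : manifold F} (a : X)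
    (E : completeNormedModType R) (O : set X) (ev : E -> X -> R) : Prop :=
  AdmissibleClass {
  ac_nbhs : open_nbhs a O;
  ac_chart : O `<=` cdom (chart_at a);
  ac_linear : forall c e e' x, O x -> ev (c *: e + e') x = c * ev e x + ev e' x;
  ac_smooth : forall e x, O x -> vsmooth_at (ev e) x;
  ac_inj : forall e e', (forall x, O x -> ev e x = ev e' x) -> e = e' }.

(* rho(psi) is the restriction to L(V) of d psi_a : W -> R. *)
Definition rho {F : normedModType R} {X : manifold F} (a : X)
    {E : completeNormedModType R} (ev : E -> X -> R) (e : E) : F -> R :=
  vderiv (ev e) a.

(* A linear functional on the subspace K; values outside K are junk. *)
Definition functional_on {F : normedModType R} (K : set F) (l : F -> R) : Prop :=
  forall c v w, K v -> K w -> l (c *: v + w) = c * l v + l w.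

(* The local C^1 norm is taken in the chart at a; K stands for L(V), which is
   finite-dimensional, so that all its linear functionals are continuous. *)
Record scalar_richness {F : normedModType R} {X : manifold F} (a : X)
    (E : completeNormedModType R) (O : set X) (ev : E -> X -> R) (K : set F) :
    Prop := ScalarRichness {
  sr_C1 : exists C, forall e x, O x ->
    `|ev e x| <= C * `|e| /\
    forall w, `|chart_deriv (chart_at a) (id_chart R) (ev e) x w|
              <= C * `|e| * `|w|;
  sr_continuous : exists C, forall e w, K w ->
    `|rho a ev e w| <= C * `|e| * `|w|;
  sr_surjective : forall l, functional_on K l ->
    exists e, forall w, K w -> rho a ev e w = l w }.

End Core.

(* Main.v *)
(** By the chain rule, the response of [psi \o A] is [d psi] composed with
    [L], so it factors through [L].  If [L] is injective, each coordinate
    [v |-> v_i] of [V] is [l_i \o L] for a functional [l_i] on [L(V)]; scalar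
    richness realises [l_i] by some [psi_i], and the joint response of
    [psi_1, ..., psi_m] is then the identity of [V]. *)

Require Import Defs.
From HB Require Import structures.
From mathcomp Require Import all_boot all_order all_algebra.
From mathcomp Require Import all_classical all_reals all_analysis.
Import Order.TTheory GRing.Theory Num.Theory numFieldNormedType.Exports.
Local Open Scope classical_set_scope.
Local Open Scope ring_scope.

(** The first-order expansion at [x] only involves the germ of the function. This is needed because
    a chart and its inverse cancel only on the chart domain. *)
Lemma near_eq_is_diff (R : numFieldType) (V W : normedModType R)
    (f g df : V -> W) (x : V) :
  (\forall y \near x, f y = g y) -> is_diff x f df -> is_diff x g df.
Proof.
move=> fg [dfx <-].
have gx : g x = f x by rewrite (nbhs_singleton fg).
have gE : g \o shift x = cst (g x) + 'd f x +o_ 0 id.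
  apply/eqaddoP => e e0; have := diff_locally dfx.
  move/eqaddoP => /(_ e e0) fe.
  have fg0 : \forall h \near 0, f (h + x) = g (h + x).
    by move: fg; rewrite (near_shift 0 x); apply: filterS => h; rewrite /= subr0.
  apply: filterS2 fe fg0 => h + fgh.
  by rewrite /= !fctE /= gx fgh.
(* A continuous linear map satisfying the expansion [gE] must be the differential of [g]. *)
have dg : 'd g x = 'd f x :> (V -> W).
  by apply: diff_unique gE; exact: diff_continuous.
apply: DiffDef => //; apply/diff_locallyP.
by rewrite dg; split=> //; exact: diff_continuous.
Qed.

(** The row is the sum of the [f i] times the basis rows, hence differentiable; its differential is
    then found entrywise through directional derivatives. *)
Lemma is_diff_row (R : realFieldType) (V : normedModType R) (r : nat)
    (f df : 'I_r -> V -> R) (x : V) :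
  (forall i, is_diff x (f i) (df i)) ->
  is_diff x (fun y => \row_i f i y) (fun v => \row_i df i v).
Proof.
move=> fdf.
have rowE : (fun y => \row_i f i y) = \sum_i (fun y => f i y *: delta_mx 0 i).
  apply/funext => y; rewrite fct_sumE; apply/rowP => j.
  rewrite mxE summxE (bigD1 j) //= !mxE !eqxx mulr1 big1 ?addr0 // => i ij.
  by rewrite !mxE eq_sym (negbTE ij) andbF mulr0.
have drow : differentiable (fun y => \row_i f i y) x.
  rewrite rowE; apply: differentiable_sum => i; apply: differentiableZl.
  by have [] := fdf i.
apply: DiffDef => //; apply/funext => v.
rewrite -deriveE // derive_mx; last exact: diff_derivable.
apply/rowP => j; rewrite !mxE.
have [dfj dfE] := fdf j.
rewrite (_ : (fun t => _) = f j); last by apply/funext => y; rewrite mxE.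
by rewrite deriveE // dfE.
Qed.

Lemma smooth_near_differentiable (R : realType) (E F : normedModType R)
    (f : E -> F) (x : E) : smooth_near f x -> differentiable f x.
Proof. by move=> [U [_ Ux]] /(_ 1)[+ _]; exact. Qed.

Section ChainRule.
Context {R : realType} {E F H : normedModType R}.
Context {S : manifold E} {X : manifold F}.
Variables (A : S -> X) (p : S) (psi : X -> H).
Hypotheses (smA : chart_smooth (chart_at p) (chart_at (A p)) A p)
  (smpsi : vsmooth_at psi (A p)).

(** In coordinates the two factors compose with an extra [cinv e \o cfun e] in between, which is the
    identity near [A p]. Differentiability is kept in the conclusion so that several observations
    can be assembled into a row. *)
Lemma is_diff_vderiv_comp :
  is_diff (cfun (chart_at p) p) (psi \o A \o cinv (chart_at p))
    (vderiv psi (A p) \o mderiv A p).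
Proof.
have [Ac /smooth_near_differentiable dA] := smA.
have [_ /smooth_near_differentiable dpsi] := smpsi.
set c := chart_at p in dA *; set e := chart_at (A p) in dA dpsi *.
have [_ _ cK _ cinvc] := mfd_chart (mfd_chart_at p).
have [eo _ eK _ _] := mfd_chart (mfd_chart_at (A p)).
have cp : cinv c (cfun c p) = p by apply/cK/mfd_dom.
have dcomp : is_diff (cfun c p)
    ((id \o psi \o cinv e) \o (cfun e \o A \o cinv c))
    (vderiv psi (A p) \o mderiv A p).
  have dpsi' : differentiable (id \o psi \o cinv e)
      ((cfun e \o A \o cinv c) (cfun c p)) by rewrite /= cp.
  apply: DiffDef; first exact: differentiable_comp.
  by rewrite diff_comp //= cp.
apply: near_eq_is_diff dcomp.
(* Continuity keeps the images of nearby points inside [cdom e], where [cinv e] undoes [cfun e]. *)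
have Acinv : {for cfun c p, continuous (A \o cinv c)}.
  apply: continuous_comp; last by rewrite /= cp.
  by apply: cinvc; exists p => //; exact: mfd_dom.
have : nbhs ((A \o cinv c) (cfun c p)) (cdom e).
  by rewrite /= cp; apply: open_nbhs_nbhs; split=> //; exact: mfd_dom.
by move/Acinv; apply: (@filterS _ (nbhs (cfun c p))) => y /= ey; rewrite eK.
Qed.

Lemma vderiv_comp : vderiv (psi \o A) p = vderiv psi (A p) \o mderiv A p.
Proof. by have [_ <-] := is_diff_vderiv_comp. Qed.

End ChainRule.

Theorem theorem5p47 (R : realType) (m n d q : nat)
    (S : manifold 'rV[R]_m) (p0 : S) (M : manifold 'rV[R]_n)
    (G : lie_group R q) (actM : G -> M -> M) (lam : R) (gam : R -> M)
    (g : S -> M -> 'M[R]_n)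
    (S_countable : @second_countable S) (M_compact : compact [set: M])
    (einstein_g : normalized_einstein_family actM lam gam g)
    (N : manifold 'rV[R]_d) (actN : G -> N -> N) (h : N -> 'M[R]_d)
    (N_compact : compact [set: N]) (h_metric : riemannian h)
    (actN_smooth : smooth_action actN) (h_invariant : invariant_metric actN h)
    (k : nat) (al : R) (k_ge4 : (4 <= k)%N) (al_gt0 : 0 < al) (al_lt1 : al < 1)
    (f0 : M -> N) (cmap : set (M -> N))
    (cvar cres : (M -> N) -> set (M -> 'rV[R]_d))
    (f0_admissible : admissible_maps actM actN k al f0 cmap f0)
    (f0_harmonic : harmonic_map (g p0) h f0)
    (B1 B2 : completeNormedModType R) (U : set B1) (Phi : B1 -> M -> N)
    (Theta : B1 -> B2 -> M -> 'rV[R]_d)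
    (trivialization :
      local_trivialization actM actN k al f0 cmap cvar cres U Phi Theta)
    (tau : S -> B1 -> B2) (u : S -> B1) (Gr : S -> B2 -> B1)
    (harmonic_f : harmonic_family f0 p0 g h U Phi Theta tau u Gr)
    (W : completeNormedModType R) (X : manifold W)
    (opJ : X -> B1 -> B2) (opG : X -> B2 -> B1) (A : S -> X)
    (core_A : core_package opJ opG (jacobi tau u) Gr A) :
  let a0 : X := A p0 in
  let L : 'rV[R]_m -> W := mderiv A p0 in
  [/\ (forall psi : X -> R, smooth_about a0 psi ->
         forall v : 'rV[R]_m, L v = 0 -> vderiv (psi \o A) p0 v = 0),
      (forall (I : Type) (psi : I -> X -> R),
         (forall i, smooth_about a0 (psi i)) ->
         infinitesimally_complete p0 (fun i => psi i \o A) -> injective L) &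
      (forall (E : completeNormedModType R) (O : set X) (ev : E -> X -> R),
         injective L -> admissible_class a0 O ev ->
         scalar_richness a0 O ev (range L) ->
         exists psi : 'I_m -> E,
           joint_infinitesimally_complete p0
             (fun p : S => \row_(i < m) ev (psi i) (A p)))].
Proof.
move=> a0 L.
have smA : chart_smooth (chart_at p0) (chart_at a0) A p0 := cp_smooth core_A p0.
have Llin (b : R) v w : L (b *: v + w) = b *: L v + L w by exact: linearP.
have chain (psi : X -> R) : smooth_about a0 psi ->
    vderiv (psi \o A) p0 = vderiv psi a0 \o L.
  by move=> [B [_ Ba0] /(_ _ Ba0)]; exact: vderiv_comp.
split=> [psi /chain -> v /= ->|I psi smpsi complete v w Lvw|E O ev Linj adm rich].
- exact: linear0.
(* Every response factors through [L], so vectors with the same image under [L] have the same joint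
   response. *)
- apply: complete; apply/funext => i.
  by rewrite (chain _ (smpsi i)) /= Lvw.
have Oa0 : O a0 by have [_ ] := ac_nbhs adm.
(* Outside [range L] this is an arbitrary default value, harmless since [functional_on] only
   constrains values on [range L]. *)
pose Linv w := get [set v | L v = w].
have LK : cancel L Linv.
  by move=> v; apply: Linj; exact: (@getPex _ [set v' | L v' = L v]) (ex_intro _ v _).
have coord_functional (i : 'I_m) :
    functional_on (range L) (fun w => Linv w 0 i).
  by move=> b _ _ [v _ <-] [w _ <-]; rewrite -Llin !LK !mxE.
have /choice[psi psiE] := fun i => sr_surjective rich (coord_functional i).
exists psi.
(* By the choice of [psi], the [i]-th response at [v] is [Linv (L v) 0 i], which is the coordinate
   [v 0 i]. *)
have dTheta : is_diff (cfun (chart_at p0) p0)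
    (fun y => \row_i (ev (psi i) \o A \o cinv (chart_at p0)) y) id.
  rewrite (_ : id = fun v => \row_i (vderiv (ev (psi i)) a0 \o L) v).
    by apply: is_diff_row => i; apply: is_diff_vderiv_comp (ac_smooth adm _ Oa0).
  apply/funext => v; apply/rowP => i.
  by rewrite mxE /= [RHS]psiE ?LK //; exists v.
move=> v w; rewrite /vderiv /chart_deriv /=.
by have [_ /= ->] := dTheta.
Qed.
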